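(* Let $V,d\ge1$. Let $\phi_t(\mathbf{x})\in\mathbb{R}^V$ be the normalized tf-idf feature vector of a text document $\mathbf{x}$ (nonnegative entries, $\|\phi_t(\mathbf{x})\|_2=1$). Let $\mathbf{w}_1,\dots,\mathbf{w}_L\in\mathbb{R}^V$ be label embeddings with nonnegative entries and $\|\mathbf{w}_i\|_2\le1$. For a feature vector $\phi$ and embeddings $\mathbf{a},\mathbf{b}$ define $\mu(\phi,\mathbf{a},\mathbf{b})=\langle\phi,\mathbf{a}-\mathbf{b}\rangle$. Let $p$ be a positive label and let $\mathbb{N}_p=\{n_1,\dots,n_{M_p}\}$ be the set of negative labels ranked below $p$ by the linear (SVM) scorer, i.e. $\mu(\phi_t(\mathbf{x}),\mathbf{w}_p,\mathbf{w}_{n_i})>0$ for all $i$. Let $\delta>0$ and, for each label $l\in\{p,n_1,\dots,n_{M_p}\}$, let $\mathbf{v}_l$ be a keyword-selected label embedding ($v_{lj}=w_{lj}$ if $j$ lies in a chosen keyword set $\mathbb{K}_l\subseteq\{1,\dots,V\}$ and $0$ otherwise) that is $\delta$-bounded, i.e. $\langle\phi_t(\mathbf{x}),\mathbf{v}_l\rangle\ge\langle\phi_t(\mathbf{x}),\mathbf{w}_l\rangle-\delta$. Let $\epsilon_i=\mu(\phi_t(\mathbf{x}),\mathbf{v}_p,\mathbf{v}_{n_i})$ and $\epsilon=\min\{\epsilon_1,\dots,\epsilon_{M_p}\}$. Let $\mathbf{E}\in\mathbb{R}^{d\times V}$ be a random matrix with entries sampled independently from the normal distribution $N(0,d^{-1/2})$,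 and for each $i$ let $\mathcal{E}_i$ be the event $\mu(\mathbf{E}\phi_t(\mathbf{x}),\mathbf{E}\mathbf{v}_p,\mathbf{E}\mathbf{v}_{n_i})\le0$. Then $$P(\mathcal{E}_1\cup\dots\cup\mathcal{E}_{M_p})\le 4M_p\exp\Bigl(-\frac{(\epsilon-\delta)^2d}{50}\Bigr),$$ and, when $\epsilon-\delta\ge 10\sqrt{\frac{\log M_p}{d}}$, $P(\mathcal{E}_1\cup\dots\cup\mathcal{E}_{M_p})\le\frac{1}{M_p}$.
   Context: The matrix $\mathbf{E}$ models a word embedding matrix; a sparse vector $\mathbf{a}\in\mathbb{R}^V$ is embedded as $\mathbf{E}\mathbf{a}\in\mathbb{R}^d$. Probabilities are over the randomness of $\mathbf{E}$. The notation $N(0,d^{-1/2})$ is as printed in the paper (the Johnson–Lindenstrauss setting, where entries have standard deviation $d^{-1/2}$).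
   Formalization: The first bound is proved under the added assumption δ ≤ ε; without it the bound fails (e.g. φ = w_p = e₁, w_n = e₁/2, δ = 1, empty keyword set for p, d large). The set of negative labels is taken to be nonempty so that the minimum ε exists. *)

(* Defs.v *)
From HB Require Import structures.
From mathcomp Require Import all_boot all_order all_algebra.
From mathcomp Require Import all_classical all_reals all_analysis.
Set Implicit Arguments. Unset Strict Implicit. Unset Printing Implicit Defensive.
Import Order.TTheory GRing.Theory Num.Theory.
Local Open Scope classical_set_scope.
Local Open Scope ring_scope.

Definition dotv (R : realType) (n : nat) (a b : 'I_n -> R) : R :=
  \sum_(j < n) a j * b j.

Definition norm2 (R : realType) (n : nat) (a : 'I_n -> R) : R :=
  Num.sqrt (dotv a a).

Definition mu (R : realType) (n : nat) (phi a b : 'I_n -> R) : R :=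
  dotv phi (fun j => a j - b j).

Definition matvec (R : realType) (d V : nat) (E : 'I_d -> 'I_V -> R)
  (a : 'I_V -> R) : 'I_d -> R :=
  fun i => \sum_(j < V) E i j * a j.

Definition keyword_select (R : realType) (V : nat) (K : {set 'I_V})
  (w : 'I_V -> R) : 'I_V -> R :=
  fun j => if j \in K then w j else 0.

(* Mutual independence of a finite family of real random variables:
   product rule for every choice of Borel sets (choosing B k = setT
   covers all subfamilies). *)
Definition mutually_independent d (T : measurableType d) (R : realType)
  (P : probability T R) (I : finType) (X : I -> T -> R) : Prop :=
  forall B : I -> set R, (forall k, measurable (B k)) ->
    P (\bigcap_(k in [set: I]) (X k @^-1` B k)) =
    (\prod_(k : I) P (X k @^-1` B k))%E.

(* X is a random variable with law N(m, s) (s = standard deviation) *)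
Definition normally_distributed d (T : measurableType d) (R : realType)
  (P : probability T R) (X : T -> R) (m s : R) : Prop :=
  measurable_fun [set: T] X /\
  forall B : set R, measurable B -> P (X @^-1` B) = normal_prob m s B.

(* Main.v *)
Require Import Defs.
From HB Require Import structures.
From mathcomp Require Import all_boot all_order all_algebra.
From mathcomp Require Import all_classical all_reals all_analysis.
From mathcomp Require Import measurable_realfun ring lra.
Set Implicit Arguments. Unset Strict Implicit. Unset Printing Implicit Defensive.
Import Order.TTheory GRing.Theory Num.Theory.
Local Open Scope classical_set_scope.
Local Open Scope ring_scope.

(** Put [a := v_p - v_(n_i)] and [c := <phi, a>]. Nonnegativity of the label
    embeddings gives [|a|^2 <= 2], and [c >= eps >= delta > 0]. The scalar
    [<E phi, E a>] is a sum of [d] independent products [X * Y] of jointly Gaussian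
    variables, whose exponential moment is explicit:
      [E exp (- theta * X * Y) =
         ((1 + theta * Cov(X, Y))^2 - theta^2 * Var X * Var Y)^(-1/2)].
    It is computed by integrating out the entries of the matrix one at a time, which
    only requires completing the square in one variable. Markov's inequality with
    [theta = c * d / 6] then yields [P(<E phi, E a> <= 0) <= exp (- c^2 * d / 50)],
    and both claims follow by a union bound over the negative labels. *)

(** * Integration against a one-dimensional normal law *)

(** The change of variables is stated with the Radon-Nikodym derivative, which agrees almost
    everywhere with the explicit density because both have the same integral over every measurable
    set. *)
Lemma ge0_integral_normal_prob (R : realType) (m s : R)
    (f : R -> \bar R) :
  (forall x, (0 <= f x)%E) -> measurable_fun [set: R] f ->
  (\int[normal_prob m s]_x f x =
   \int[lebesgue_measure]_x (f x * (normal_pdf m s x)%:E))%E.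
Proof.
move=> f0 mf.
have dom := normal_prob_dominates m s.
rewrite -(Radon_Nikodym_SigmaFinite.change_of_variables dom f0)//.
have mpdf : measurable_fun [set: R] (EFin \o normal_pdf m s).
  by apply/measurable_EFinP; exact: measurable_normal_pdf.
have mRN : measurable_fun [set: R]
    (Radon_Nikodym_SigmaFinite.f (normal_prob m s) lebesgue_measure).
  exact: measurable_int (Radon_Nikodym_SigmaFinite.f_integrable dom).
apply: ae_eq_integral => //.
- exact: emeasurable_funM.
- exact: emeasurable_funM.
- apply: ae_eqe_mul2l; apply: integral_ae_eq => //.
    exact: Radon_Nikodym_SigmaFinite.f_integrable.
  by move=> A _ mA; rewrite -Radon_Nikodym_SigmaFinite.f_integral.
Qed.

Lemma normal_peak_ratio (R : realType) (s k : R) : 0 < s -> 0 < k ->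
  normal_peak s = k^-1 * normal_peak (s / k).
Proof.
move=> s0 k0; rewrite /normal_peak.
have -> : s ^+ 2 * pi *+ 2 = k ^+ 2 * ((s / k) ^+ 2 * pi *+ 2).
  by field; rewrite gt_eqF.
by rewrite sqrtrM ?sqr_ge0// sqrtr_sqr gtr0_norm// invfM.
Qed.

(** Completing the square: with [D = 1 + a * s ^+ 2], the integrand times the density is a constant
    times the normal density of mean [- b * s ^+ 2 / D] and standard deviation [s / Num.sqrt D]. The
    coefficient [a] may be negative as long as [D > 0]. *)
Lemma integral_expR_quadratic_normal (R : realType) (s a b c : R) : 0 < s ->
  0 < 1 + a * s ^+ 2 ->
  (\int[normal_prob 0 s]_x (expR (- (a * x ^+ 2 / 2 + b * x + c)))%:E =
   ((Num.sqrt (1 + a * s ^+ 2))^-1 *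
    expR (b ^+ 2 * s ^+ 2 / (2 * (1 + a * s ^+ 2)) - c))%:E)%E.
Proof.
move=> s0 D0; set D := 1 + a * s ^+ 2 in D0 *.
set k := Num.sqrt D.
have k0 : 0 < k by rewrite sqrtr_gt0.
have kD : k ^+ 2 = D by rewrite sqr_sqrtr// ltW.
rewrite ge0_integral_normal_prob//; last first.
  apply/measurable_EFinP; apply: measurableT_comp => //.
  apply: measurableT_comp => //; apply: measurable_funD => //.
  apply: measurable_funD => //.
  by apply: measurable_funM => //; apply: measurable_funM.
have sk0 : s / k != 0 by rewrite gt_eqF// divr_gt0.
pose m := - b * s ^+ 2 / D.
set K := k^-1 * _.
transitivity (\int[lebesgue_measure]_x (K%:E * (normal_pdf m (s / k) x)%:E))%E.
  apply: eq_integral => x _; rewrite -!EFinM; congr (_%:E).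
  rewrite !normal_pdfE ?gt_eqF ?divr_gt0// (normal_peak_ratio s0 k0).
  rewrite /normal_fun /K mulrCA -!mulrA; congr (_ * _).
  rewrite [RHS]mulrCA; congr (_ * _).
  rewrite -!expRD; congr expR.
  rewrite expr_div_n kD /m /D; field.
  by rewrite -/D !gt_eqF.
rewrite ge0_integralZl//; last 3 first.
- by apply/measurable_EFinP; exact: measurable_normal_pdf.
- by move=> x _; rewrite lee_fin normal_pdf_ge0.
- by rewrite lee_fin mulr_ge0 ?expR_ge0 ?invr_ge0 ?ltW.
by rewrite integral_normal_pdf mule1.
Qed.

(** * Joint laws of independent variables and iterated integrals *)

Section iterated_integral.
Local Open Scope ereal_scope.
Context (R : realType) (I : finType) (dU : measure_display)
  (U : measurableType dU) (mu : probability U R).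
Implicit Types (f : (I -> U) -> \bar R) (x : I -> U) (s : seq I).

Definition upd x (k : I) (y : U) : I -> U := fun j => if j == k then y else x j.

(** The head of [s] is the outermost variable of integration; [x] supplies the coordinates outside
    [s]. *)
Fixpoint iterated_integral s f x : \bar R :=
  if s is k :: s' then \int[mu]_y iterated_integral s' f (upd x k y) else f x.

(** Measurability is tested along all measurable families of coordinates, so that the function space
    [I -> U] carries no sigma-algebra of its own. *)
Definition coord_measurable f : Prop :=
  forall (d : measure_display) (S : measurableType d) (Z : I -> S -> U),
    (forall k, measurable_fun [set: S] (Z k)) ->
    measurable_fun [set: S] (fun z => f (fun k => Z k z)).

(** The total mass [c] is left free because the induction restricts the measure to cylinders, which
    are not of mass 1. *)
Definition box_rule d (T : measurableType d) (m : set T -> \bar R)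
    (X : I -> T -> U) (c : R) s : Prop :=
  forall B : I -> set U, (forall k, measurable (B k)) ->
    m [set t | forall k, k \in s -> B k (X k t)] = c%:E * \prod_(k <- s) mu (B k).

(* The restriction of m to a cylinder of the head variable satisfies the product
   rule for the tail, so the uniqueness of product measures identifies the joint
   law by induction, without any pi-lambda argument. *)
Lemma box_rule_law d (T : measurableType d) (X : I -> T -> U) s :
  (forall k, measurable_fun [set: T] (X k)) -> uniq s ->
  exists (d' : measure_display) (S : measurableType d')
      (nu : probability S R) (G : T -> S) (Y : I -> S -> U),
    [/\ measurable_fun [set: T] G,
        forall k, measurable_fun [set: S] (Y k),
        forall k t, k \in s -> Y k (G t) = X k t,
        forall (m : {finite_measure set T -> \bar R}) (c : {nonneg R}),
          box_rule m X c%:num s ->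
          forall B, measurable B -> m (G @^-1` B) = c%:num%:E * nu B &
        forall f x, (forall y, 0 <= f y) -> coord_measurable f ->
          \int[nu]_z f (fun k => if k \in s then Y k z else x k) =
          iterated_integral s f x].
Proof.
move=> mX; elim: s => [_|k s IH /andP[ks us]].
  exists _, unit, (\d_tt : probability unit R), (fun=> tt), (fun _ _ => point).
  split => //.
  - move=> m c /(_ (fun=> setT)) /(_ (fun=> measurableT)).
    rewrite big_nil mule1 (_ : [set t | _] = setT); last first.
      by apply/seteqP; split => // t _ k.
    move=> mT B mB; rewrite /= diracE; have [Btt|Btt] := pselect (B tt).
      rewrite mem_set// mule1 -mT; congr (m _).
      by apply/seteqP; split.
    rewrite memNset// mule0 (_ : _ @^-1` _ = set0) ?measure0//.
    by apply/seteqP; split.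
  - move=> f x f0 mf; rewrite integral_dirac// ?diracT ?mul1e//.
have {IH} [d' [S [nu [G [Y [mG mY YG law int]]]]]] := IH us.
pose G' t := (X k t, G t).
pose Y' j (z : U * S) := if j == k then z.1 else Y j z.2.
have mG' : measurable_fun setT G' by exact: measurable_fun_pair.
have mY' j : measurable_fun setT (Y' j).
  rewrite /Y'; case: (j == k); first exact: measurable_fst.
  exact: measurableT_comp (measurable_snd).
pose nu' : probability (U * S)%type R := (mu \x nu).
exists _, _, nu', G', Y'; split => //.
- move=> j t; rewrite inE /Y' /G' /=; case: eqP => [->//|_] /=.
  exact: YG.
- move=> m c mc W mW.
  have boxE A C : measurable A -> measurable C ->
      m (G' @^-1` (A `*` C)) = c%:num%:E * (mu A * nu C).
    move=> mA mC.
    have mXA : measurable (X k @^-1` A) by rewrite -[_ @^-1` _]setTI; exact: mX.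
    (* Restricting [m] to [X k] in [A] multiplies its constant by [mu A]; this is the constant at
       which the induction hypothesis is used. *)
    have c0 : (0 <= c%:num * fine (mu A))%R by rewrite mulr_ge0// fine_ge0.
    have -> : G' @^-1` (A `*` C) = G @^-1` C `&` X k @^-1` A.
      by apply/seteqP; split => t [].
    rewrite -[LHS]/(mrestr m mXA (G @^-1` C)) (law _ (NngNum c0))//; last first.
      move=> B mB /=; pose B' j := if j == k then A else B j.
      have -> : mrestr m mXA [set t | forall j, j \in s -> B j (X j t)] =
                m [set t | forall j, j \in k :: s -> B' j (X j t)].
        rewrite /mrestr; congr (m _); apply/seteqP; split => t /=.
          move=> [Bt At] j; rewrite inE /B'; case: eqP => [->//|_] /=.
          exact: Bt.
        move=> Bt; split => [j js|]; last first.
          by have := Bt k; rewrite inE /B' eqxx => /(_ isT).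
        have := Bt j; rewrite inE js orbT /B' => /(_ isT).
        by case: eqP => // jk; rewrite -jk js in ks.
      rewrite mc; last by move=> j; rewrite /B'; case: ifP.
      rewrite big_cons {1}/B' eqxx EFinM fineK ?fin_num_measure// -muleA.
      congr (_ * (_ * _)); apply: eq_big_seq => j js; rewrite /B'.
      by case: eqP => // jk; rewrite -jk js in ks.
    by rewrite /= EFinM fineK ?fin_num_measure// muleA.
  rewrite -[LHS]/(pushforward m G' W).
  (* Uniqueness is applied twice: the constant is first put on one factor, which keeps the reference
     a product measure, and is then pulled out. *)
  transitivity ((mscale c mu \x nu) W).
    apply/esym; apply: product_measure_unique => // A C mA mC.
    by rewrite /= /pushforward boxE// /mscale muleA.
  rewrite (product_measure_unique (m' := mscale c (mu \x nu)))// => A C mA mC.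
  by rewrite /= /mscale -muleA; congr (_ * _); exact: product_measure1E.
- move=> f x f0 mf.
  rewrite fubini_tonelli1//; last first.
    apply: (mf _ _ (fun j z => if j \in k :: s then Y' j z else x j)) => j.
    by case: (j \in k :: s); [exact: mY'|exact: measurable_cst].
  apply: eq_integral => y _; rewrite -[RHS]/(iterated_integral s f (upd x k y)) -int//.
  apply: eq_integral => z _.
  congr f; apply/funext => j; rewrite inE /Y' /upd /=.
  by case: eqP => [->|_] /=; [rewrite (negbTE ks)|].
Qed.

(** For constant 1, [box_rule_law] says that [G] pushes [P] forward to [nu], on which Tonelli has
    already turned the integral into an iterated one. *)
Lemma ge0_integral_box_rule d (T : measurableType d) (P : probability T R)
    (X : I -> T -> U) f x :
  (forall k, measurable_fun [set: T] (X k)) ->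
  box_rule P X 1 (enum I) ->
  (forall y, 0 <= f y) -> coord_measurable f ->
  \int[P]_t f (X ^~ t) = iterated_integral (enum I) f x.
Proof.
move=> mX PX f0 mf.
have [d' [S [nu [G [Y [mG mY YG law int]]]]]] := box_rule_law mX (enum_uniq I).
rewrite -int//.
have nuE B : measurable B -> pushforward P G B = nu B.
  by move=> mB; rewrite /pushforward (law P (1%:nng)%R)// mul1e.
have mfY : measurable_fun setT
    (fun z => f (fun k => if k \in enum I then Y k z else x k)).
  apply: (mf _ _ (fun k z => if k \in enum I then Y k z else x k)) => k.
  by case: (k \in enum I); [exact: mY|exact: measurable_cst].
transitivity (\int[pushforward P G]_z
    f (fun k => if k \in enum I then Y k z else x k)); last first.
  by apply: eq_measure_integral => // A mA _; exact: nuE.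
rewrite ge0_integral_pushforward// preimage_setT; apply: eq_integral => t _ /=.
by congr f; apply/funext => k; rewrite mem_enum YG ?mem_enum.
Qed.
End iterated_integral.

(** * The exponential moment of a product of two Gaussian variables *)

Section gaussian_bilinear_form.
Context (R : realType) (theta : R).
Implicit Types r c q x y : R.

Definition bilin_disc r c q : R := (1 + theta * c) ^+ 2 - theta ^+ 2 * (r * q).

(* For a centered Gaussian pair [(X, Y)] with covariance matrix
   [[r, c], [c, q]], this is the expectation of
   [exp (- theta * (x + X) * (y + Y))]. *)
Definition bilin_mgf r c q x y : R :=
  (Num.sqrt (bilin_disc r c q))^-1 *
  expR (- ((theta * (1 + theta * c) * (x * y) -
            theta ^+ 2 * (q * x ^+ 2 + r * y ^+ 2) / 2) / bilin_disc r c q)).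

Lemma bilin_mgf_ge0 r c q x y : 0 <= bilin_mgf r c q x y.
Proof. by rewrite mulr_ge0 ?expR_ge0 ?invr_ge0. Qed.

Lemma bilin_mgf0 x y : bilin_mgf 0 0 0 x y = expR (- (theta * (x * y))).
Proof.
rewrite /bilin_mgf (_ : bilin_disc 0 0 0 = 1); last by rewrite /bilin_disc; ring.
by rewrite sqrtr1 invr1 mul1r; congr expR; field.
Qed.

Lemma measurable_bilin_mgf_affine (r c q x y p b : R) :
  measurable_fun [set: R] (fun g => bilin_mgf r c q (x + p * g) (y + b * g)).
Proof.
apply: measurable_funM => //; apply: measurableT_comp => //.
apply: measurableT_comp => //; apply: measurable_funM => //.
have mL (u v : R) : measurable_fun [set: R] (fun g : R => u + v * g).
  by apply: measurable_funD => //; exact: measurable_funM.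
apply: measurable_funB.
  by apply: measurable_funM => //; exact: measurable_funM.
apply: measurable_funM => //; apply: measurable_funM => //.
by apply: measurable_funD; apply: measurable_funM => //; exact: measurable_funX.
Qed.

(** Adding an independent Gaussian step [(p * g, b * g)] to the pair adds [s ^+ 2] times a rank-one
    matrix to its covariance; the family [bilin_mgf] is stable under this operation. *)
Lemma integral_bilin_mgf_normal (s r c q x y p b : R) : 0 < s ->
  0 < bilin_disc r c q ->
  0 < bilin_disc (r + s ^+ 2 * (p * p)) (c + s ^+ 2 * (p * b))
        (q + s ^+ 2 * (b * b)) ->
  (\int[normal_prob 0 s]_g (bilin_mgf r c q (x + p * g) (y + b * g))%:E =
   (bilin_mgf (r + s ^+ 2 * (p * p)) (c + s ^+ 2 * (p * b))
      (q + s ^+ 2 * (b * b)) x y)%:E)%E.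
Proof.
move=> s0 D0 D'0; set D := bilin_disc r c q in D0 *.
set D' := bilin_disc _ _ _ in D'0 *.
set r' := r + _; set c' := c + _; set q' := q + _.
(* As a polynomial in [g], the numerator of the exponent is [nA * g ^+ 2 / 2 + nB * g + nC]; [nC']
   is its counterpart after integration. *)
pose nA := 2 * theta * (1 + theta * c) * p * b -
  theta ^+ 2 * (q * p ^+ 2 + r * b ^+ 2).
pose nB := theta * (1 + theta * c) * (x * b + y * p) -
  theta ^+ 2 * (q * x * p + r * y * b).
pose nC := theta * (1 + theta * c) * (x * y) -
  theta ^+ 2 * (q * x ^+ 2 + r * y ^+ 2) / 2.
pose nC' := theta * (1 + theta * c') * (x * y) -
  theta ^+ 2 * (q' * x ^+ 2 + r' * y ^+ 2) / 2.
have D_neq0 : D != 0 by rewrite gt_eqF.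
have D'_neq0 : D' != 0 by rewrite gt_eqF.
have AD : 1 + nA / D * s ^+ 2 = D' / D.
  apply: (mulfI D_neq0); rewrite [RHS]mulrCA divff// mulr1.
  transitivity (D + nA * s ^+ 2); first by field.
  by rewrite /nA /D /D' /bilin_disc; ring.
(* The square leaves an exponent with denominator [D * D']; this polynomial identity cancels the old
   discriminant [D]. *)
have BC : nB ^+ 2 * s ^+ 2 / 2 - nC * D' = - nC' * D.
  by rewrite /nB /nC /nC' /D /D' /r' /c' /q' /bilin_disc; field.
transitivity (\int[normal_prob 0 s]_g ((Num.sqrt D)^-1%:E *
    (expR (- (nA / D * g ^+ 2 / 2 + nB / D * g + nC / D)))%:E))%E.
  apply: eq_integral => g _; rewrite -EFinM; congr ((_ * expR _)%:E).
  by rewrite -/D /nA /nB /nC; field.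
rewrite ge0_integralZl//; last first.
  apply/measurable_EFinP; apply: measurableT_comp => //.
  apply: measurableT_comp => //; apply: measurable_funD => //.
  apply: measurable_funD => //.
  by apply: measurable_funM => //; apply: measurable_funM.
rewrite integral_expR_quadratic_normal ?AD ?divr_gt0// -EFinM; congr (_%:E).
rewrite /bilin_mgf -/D' -/nC' [LHS]mulrA; congr (_ * expR _).
  by rewrite -invfM -sqrtrM ?ltW// mulrCA divff// mulr1.
transitivity ((nB ^+ 2 * s ^+ 2 / 2 - nC * D') / (D * D')).
  by field; apply/andP.
by rewrite BC; field; apply/andP.
Qed.
End gaussian_bilinear_form.

(** * Integrating out the matrix entries one at a time *)

Section gaussian_rows.
Context (R : realType) (d V : nat) (theta sigma : R) (phi a : 'I_V -> R).
Implicit Types (u w : 'I_V -> R) (t : seq ('I_d * 'I_V)) (x : 'I_d * 'I_V -> R).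

(** The list [t] holds the entries already integrated out. In row [i] they contribute the covariance
    [row_cov], while the remaining entries stay frozen in [row_rest]. *)
Definition row_cov t (i : 'I_d) u w : R :=
  sigma ^+ 2 * \sum_(j | (i, j) \in t) u j * w j.

Definition row_rest t (i : 'I_d) u x : R :=
  \sum_(j | (i, j) \notin t) u j * x (i, j).

Definition row_mgf t x (i : 'I_d) : R :=
  bilin_mgf theta (row_cov t i phi phi) (row_cov t i phi a) (row_cov t i a a)
    (row_rest t i phi x) (row_rest t i a x).

Lemma row_cov_head i j t u w : (i, j) \notin t ->
  row_cov ((i, j) :: t) i u w = row_cov t i u w + sigma ^+ 2 * (u j * w j).
Proof.
move=> ijt; rewrite /row_cov -mulrDr; congr (_ * _).
rewrite (bigD1 j) /= ?inE ?eqxx// addrC; congr (_ + _).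
apply: eq_bigl => l; rewrite inE xpair_eqE eqxx /=.
by case: eqVneq => [->|_] /=; rewrite ?(negbTE ijt) ?andbT ?andbF.
Qed.

Lemma row_cov_other i i' j t u w : i' != i ->
  row_cov ((i, j) :: t) i' u w = row_cov t i' u w.
Proof.
move=> i'i; rewrite /row_cov; congr (_ * _); apply: eq_bigl => l.
by rewrite inE xpair_eqE (negbTE i'i).
Qed.

Lemma row_rest_head i j t u x y : (i, j) \notin t ->
  row_rest t i u (upd x (i, j) y) = row_rest ((i, j) :: t) i u x + u j * y.
Proof.
move=> ijt; rewrite /row_rest (bigD1 j) //= /upd eqxx addrC; congr (_ + _).
apply: eq_big => [l|l].
  by rewrite inE xpair_eqE eqxx negb_or andbC.
by move=> /andP[_ lj]; rewrite xpair_eqE (negbTE lj) andbF.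
Qed.

Lemma row_rest_other i i' j t u x y : i' != i ->
  row_rest t i' u (upd x (i, j) y) = row_rest ((i, j) :: t) i' u x.
Proof.
move=> i'i; rewrite /row_rest /upd; apply: eq_big => [l|l _].
  by rewrite inE xpair_eqE (negbTE i'i).
by rewrite xpair_eqE (negbTE i'i).
Qed.

Hypothesis sigma_gt0 : 0 < sigma.
Hypothesis disc_gt0 : forall t i,
  0 < bilin_disc theta (row_cov t i phi phi) (row_cov t i phi a) (row_cov t i a a).

(** Induction on [t]: integrating entry [(i, j)] changes only the factor of row [i], and the other
    rows come out as a constant. Every intermediate stage needs a positive discriminant, hence
    [disc_gt0] for all [t]. *)
Lemma iterated_integral_row_mgf t x : uniq t ->
  iterated_integral (normal_prob 0 sigma) t
    (fun x => (\prod_(i < d) row_mgf [::] x i)%:E) x =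
  (\prod_(i < d) row_mgf t x i)%:E.
Proof.
elim: t x => [//|[i j] t IH] x /andP[ijt ut].
transitivity (\int[normal_prob 0 sigma]_y
    (\prod_(l < d) row_mgf t (upd x (i, j) y) l)%:E)%E.
  by apply: eq_integral => y _; exact: IH.
transitivity (\int[normal_prob 0 sigma]_y
    ((\prod_(l < d | l != i) row_mgf ((i, j) :: t) x l)%:E *
     (bilin_mgf theta (row_cov t i phi phi) (row_cov t i phi a) (row_cov t i a a)
       (row_rest ((i, j) :: t) i phi x + phi j * y)
       (row_rest ((i, j) :: t) i a x + a j * y))%:E))%E.
  apply: eq_integral => y _; rewrite -EFinM (bigD1 i)//= mulrC; congr (_ * _)%:E.
    apply: eq_bigr => l li.
    by rewrite /row_mgf !row_cov_other// !(row_rest_other _ _ _ _ _ li).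
  by rewrite /row_mgf !row_rest_head.
rewrite ge0_integralZl//; last 3 first.
- by apply/measurable_EFinP; exact: measurable_bilin_mgf_affine.
- by move=> y _; rewrite lee_fin bilin_mgf_ge0.
- by rewrite lee_fin prodr_ge0// => l _; exact: bilin_mgf_ge0.
rewrite integral_bilin_mgf_normal//; last by rewrite -!row_cov_head.
rewrite -EFinM [in RHS](bigD1 i)//= [in RHS]mulrC; congr (_ * _)%:E.
by rewrite /row_mgf !row_cov_head.
Qed.

End gaussian_rows.

(** * Exponential moment and Markov bound for the Gaussian matrix *)

Section gaussian_matrix.
Context (R : realType) (d V : nat) (dT : measure_display) (T : measurableType dT)
  (P : probability T R) (E : 'I_d -> 'I_V -> T -> R) (sigma : R).
Hypothesis sigma_gt0 : 0 < sigma.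
Hypothesis indepE : mutually_independent P (fun ij : 'I_d * 'I_V => E ij.1 ij.2).
Hypothesis normalE : forall i j, normally_distributed P (E i j) 0 sigma.

Let Et t := matvec (fun i j => E i j t).

Lemma box_rule_normal :
  box_rule (normal_prob 0 sigma) P (fun ij : 'I_d * 'I_V => E ij.1 ij.2) 1
    (enum {: 'I_d * 'I_V}).
Proof.
move=> B mB; rewrite mul1e.
have -> : [set t | forall k, k \in enum {: 'I_d * 'I_V} -> B k (E k.1 k.2 t)] =
    \bigcap_(k in [set: 'I_d * 'I_V]) (E k.1 k.2 @^-1` B k).
  apply/seteqP; split => t Bt k; first by move=> _; apply: Bt; rewrite mem_enum.
  by move=> _; exact: Bt.
rewrite indepE// big_enum /=; apply: eq_bigr => k _.
by have [_ law] := normalE k.1 k.2; apply: law; exact: mB.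
Qed.

(** At the empty list, the product of the [row_mgf] is the integrand. Once all entries are
    integrated, every row has the same full covariance, whence the power [d]. *)
Lemma integral_expR_bilin_gaussian (theta : R) (phi a : 'I_V -> R) :
  (forall t (i : 'I_d), 0 < bilin_disc theta (row_cov sigma t i phi phi)
     (row_cov sigma t i phi a) (row_cov sigma t i a a)) ->
  (\int[P]_t (expR (- (theta * dotv (Et t phi) (Et t a))))%:E =
   ((Num.sqrt (bilin_disc theta (sigma ^+ 2 * dotv phi phi)
      (sigma ^+ 2 * dotv phi a) (sigma ^+ 2 * dotv a a)))^-1 ^+ d)%:E)%E.
Proof.
move=> disc_gt0.
pose f (x : 'I_d * 'I_V -> R) :=
  (\prod_(i < d) row_mgf theta sigma phi a [::] x i)%:E.
have mgfE x i : row_mgf theta sigma phi a [::] x i =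
    expR (- (theta * ((\sum_j x (i, j) * phi j) * (\sum_j x (i, j) * a j)))).
  rewrite /row_mgf.
  have cov0 u w : row_cov sigma [::] i u w = 0.
    by rewrite /row_cov big_pred0 ?mulr0.
  have restE u : row_rest [::] i u x = \sum_j x (i, j) * u j.
    by apply: eq_bigr => j _; rewrite mulrC.
  by rewrite !cov0 !restE bilin_mgf0.
transitivity (\int[P]_t f (fun ij => E ij.1 ij.2 t))%E.
  apply: eq_integral => t _; congr (_%:E).
  under eq_bigr do rewrite mgfE.
  rewrite -expR_sum; congr expR; rewrite sumrN; congr (- _).
  by rewrite /dotv mulr_sumr.
rewrite (@ge0_integral_box_rule _ _ _ _ (normal_prob 0 sigma) _ _ _ _ _ (fun=> 0)).
- rewrite iterated_integral_row_mgf// ?enum_uniq//; congr (_%:E).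
  rewrite (eq_bigr (fun=> (Num.sqrt (bilin_disc theta (sigma ^+ 2 * dotv phi phi)
      (sigma ^+ 2 * dotv phi a) (sigma ^+ 2 * dotv a a)))^-1)).
    by rewrite prodr_const card_ord.
  move=> i _; rewrite /row_mgf.
  have covE u w : row_cov sigma (enum {: 'I_d * 'I_V}) i u w = sigma ^+ 2 * dotv u w.
    by congr (_ * _); apply: eq_bigl => j; rewrite mem_enum.
  have restE u : row_rest (enum {: 'I_d * 'I_V}) i u (fun=> 0) = 0.
    by apply: big1 => j _; rewrite mulr0.
  rewrite !covE !restE /bilin_mgf !expr0n /= !mulr0 !addr0 !mulr0 !mul0r subr0.
  by rewrite mul0r oppr0 expR0 mulr1.
- by move=> [i j]; have [] := normalE i j.
- exact: box_rule_normal.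
- by move=> x; rewrite lee_fin prodr_ge0// => i _; exact: bilin_mgf_ge0.
- move=> d' S Z mZ; apply/measurable_EFinP.
  apply: measurable_prod => i _.
  under eq_fun do rewrite mgfE.
  apply: measurableT_comp => //; apply: measurableT_comp => //.
  apply: measurable_funM => //; apply: measurable_funM.
  + by apply: measurable_sum => j; apply: measurable_funM => //; exact: mZ.
  + by apply: measurable_sum => j; apply: measurable_funM => //; exact: mZ.
Qed.

Lemma measurable_dotv_matvec (phi a : 'I_V -> R) :
  measurable_fun [set: T] (fun t => dotv (Et t phi) (Et t a)).
Proof.
apply: measurable_sum => i; apply: measurable_funM.
- by apply: measurable_sum => j; apply: measurable_funM => //; have [] := normalE i j.
- by apply: measurable_sum => j; apply: measurable_funM => //; have [] := normalE i j.
Qed.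

Lemma measurable_dotv_matvec_le0 (phi a : 'I_V -> R) :
  measurable [set t | dotv (Et t phi) (Et t a) <= 0].
Proof.
rewrite [X in measurable X](_ : _ =
    [set: T] `&` (fun t => dotv (Et t phi) (Et t a)) @^-1` `]-oo, 0]).
  by apply: measurable_dotv_matvec.
by rewrite setTI; apply/seteqP; split => t /=; rewrite in_itv.
Qed.

(** Pointwise, the exponential is at least 1 on the event and nonnegative elsewhere, so it dominates
    the indicator. *)
Lemma markov_dotv_matvec (theta : R) (phi a : 'I_V -> R) : 0 <= theta ->
  (P [set t | dotv (Et t phi) (Et t a) <= 0]%R <=
   \int[P]_t (expR (- (theta * dotv (Et t phi) (Et t a))))%:E)%E.
Proof.
move=> theta0; have mU := measurable_dotv_matvec_le0 phi a.
rewrite -[X in P X]setIT -integral_indic//; apply: ge0_le_integral => //=.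
- exact/measurable_EFinP/measurable_indic.
- apply/measurable_EFinP; apply: measurableT_comp => //; apply: measurableT_comp => //.
  by apply: measurable_funM => //; exact: measurable_dotv_matvec.
- move=> t _; rewrite lee_fin indicE; case: (boolP (t \in _)) => [|_];
    last exact: expR_ge0.
  rewrite inE /= => tU; rewrite -[leLHS]expR0 ler_expR oppr_ge0.
  exact: mulr_ge0_le0.
Qed.

End gaussian_matrix.

(** * Numerical estimates and the tail bound for one pair of vectors *)

Lemma ler_norm_sum_mul (R : realType) (I : finType) (Q : pred I) (u w : I -> R) :
  `|\sum_(j | Q j) u j * w j| <=
  (\sum_(j | Q j) u j * u j + \sum_(j | Q j) w j * w j) / 2.
Proof.
rewrite (le_trans (ler_norm_sum _ _ _))// -big_split /= mulr_suml.
apply: ler_sum => j _; rewrite ler_norml.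
have := sqr_ge0 (u j - w j); have := sqr_ge0 (u j + w j).
by rewrite !expr2 => *; apply/andP; split; nra.
Qed.

Lemma ler_sum_sqr_subset (R : realType) (n : nat) (Q : pred 'I_n) (u : 'I_n -> R) :
  \sum_(j | Q j) u j * u j <= dotv u u.
Proof.
rewrite /dotv [leRHS](bigID Q) /= lerDl sumr_ge0// => j _.
exact: sqr_ge0.
Qed.

(* Positivity of the discriminant when only part of a row has been integrated out:
   [r], [k], [q] are then partial sums, and [k] may be negative. *)
Lemma partial_disc_gt0 (R : realType) (c r q k : R) :
  0 <= c <= 3 / 2 -> 0 <= r <= 1 -> 0 <= q <= 2 -> `|k| <= (r + q) / 2 ->
  0 < (1 + c / 6 * k) ^+ 2 - (c / 6) ^+ 2 * (r * q).
Proof.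
move=> /andP[c0 c1] /andP[r0 r1] /andP[q0 q1]; rewrite ler_norml => /andP[k1 k2].
(* Since [k >= - (3 / 2)] and [c / 6 <= 1 / 4], the square is at least [25 / 64], while the
   subtracted term is at most [2 / 16]. *)
have rq : r * q <= 2 by nra.
have rq0 : 0 <= r * q by rewrite mulr_ge0.
have ck : - (3 / 8) <= c / 6 * k by nra.
have : (5 / 8) ^+ 2 <= (1 + c / 6 * k) ^+ 2 by rewrite ler_sqr ?nnegrE; lra.
have : (c / 6) ^+ 2 <= 1 / 16 by nra.
have := sqr_ge0 (c / 6).
nra.
Qed.

(** Writing [D] for the discriminant, [D >= 1 + 5 / 18 * c ^+ 2], where [5 / 18 = 1 / 3 - 2 / 36].
    With [c ^+ 2 <= 9 / 4] this gives [D * (1 - c ^+ 2 / 25) >= 1], and [1 - x <= expR (- x)] bounds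
    the inverse of [D]. *)
Lemma inv_sqrt_disc_le_expR (R : realType) (c q : R) :
  0 <= c <= 3 / 2 -> 0 <= q <= 2 ->
  (Num.sqrt ((1 + c / 6 * c) ^+ 2 - (c / 6) ^+ 2 * (1 * q)))^-1 <=
  expR (- (c ^+ 2 / 50)).
Proof.
move=> /andP[c0 c1] /andP[q0 q1]; set D := _ - _.
have c2 : 0 <= c ^+ 2 <= 9 / 4 by apply/andP; split; nra.
have cq : c ^+ 2 * q <= c ^+ 2 * 2 by nra.
have D1 : 1 + 5 / 18 * c ^+ 2 <= D by rewrite /D; nra.
have D0 : 0 < D by nra.
have -> : expR (- (c ^+ 2 / 50)) = Num.sqrt (expR (- (c ^+ 2 / 25))).
  rewrite -[LHS]ger0_norm ?expR_ge0// -sqrtr_sqr -expRM_natl.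
  congr (Num.sqrt (expR _)).
  by field.
rewrite -sqrtrV ?(ltW D0)// ler_wsqrtr//.
rewrite (le_trans _ (expR_ge1Dx _))//.
rewrite -div1r ler_pdivrMr//; nra.
Qed.

Lemma dotvv_ge0 (R : realType) (n : nat) (u : 'I_n -> R) : 0 <= dotv u u.
Proof. by apply: sumr_ge0 => j _; exact: sqr_ge0. Qed.

Lemma gaussian_dotv_le0 (R : realType) (d V : nat) (dT : measure_display)
    (T : measurableType dT) (P : probability T R) (E : 'I_d -> 'I_V -> T -> R)
    (phi a : 'I_V -> R) :
  (0 < d)%N ->
  mutually_independent P (fun ij : 'I_d * 'I_V => E ij.1 ij.2) ->
  (forall i j, normally_distributed P (E i j) 0 (Num.sqrt (d%:R^-1))) ->
  dotv phi phi = 1 -> dotv a a <= 2 -> 0 <= dotv phi a ->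
  (P [set t | dotv (matvec (fun i j => E i j t) phi)
                   (matvec (fun i j => E i j t) a) <= 0]%R <=
   (expR (- (dotv phi a ^+ 2 * d%:R / 50)))%:E)%E.
Proof.
move=> d0 indepE normalE phi1 a2 c0; set c := dotv phi a in c0 *.
have d_gt0 : 0 < d%:R :> R by rewrite ltr0n.
have d_neq0 : d%:R != 0 :> R by rewrite gt_eqF.
have sigma0 : 0 < Num.sqrt (d%:R^-1) :> R by rewrite sqrtr_gt0 invr_gt0.
have sigma2 : Num.sqrt (d%:R^-1) ^+ 2 = d%:R^-1 :> R.
  by rewrite sqr_sqrtr// invr_ge0 ltW.
(* The bound [3 / 2] is the arithmetic-geometric mean inequality with squared norms 1 and at most
   2. *)
have c32 : 0 <= c <= 3 / 2.
  rewrite c0 /=; apply: (le_trans (ler_norm _)).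
  apply: (le_trans (ler_norm_sum_mul _ _ _)).
  by rewrite -/(dotv phi phi) -/(dotv a a) phi1; lra.
(* The factor [d] compensates the variance [1 / d], so the discriminant no longer depends on [d]. *)
pose theta := c / 6 * d%:R.
have discE r k q : bilin_disc theta (d%:R^-1 * r) (d%:R^-1 * k) (d%:R^-1 * q) =
    (1 + c / 6 * k) ^+ 2 - (c / 6) ^+ 2 * (r * q).
  by rewrite /bilin_disc /theta; field.
have theta0 : 0 <= theta by rewrite mulr_ge0 ?divr_ge0// ltW.
apply: (le_trans (markov_dotv_matvec normalE _ _ theta0)).
rewrite (integral_expR_bilin_gaussian sigma0 indepE normalE); last first.
  move=> t i; rewrite /row_cov sigma2 discE; apply: partial_disc_gt0 => //.
  - rewrite sumr_ge0 => [|j _]; last exact: sqr_ge0.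
    by rewrite -phi1 ler_sum_sqr_subset.
  - rewrite sumr_ge0 => [|j _]; last exact: sqr_ge0.
    by rewrite (le_trans _ a2) ?ler_sum_sqr_subset.
  - exact: ler_norm_sum_mul.
rewrite sigma2 discE phi1 lee_fin -/c.
have -> : - (c ^+ 2 * d%:R / 50) = d%:R * - (c ^+ 2 / 50) by field.
rewrite expRM_natl lerXn2r ?nnegrE ?invr_ge0 ?sqrtr_ge0 ?expR_ge0//.
by apply: inv_sqrt_disc_le_expR; rewrite // dotvv_ge0.
Qed.

(** * Keyword-selected embeddings, the union bound and the conclusion *)

Lemma dotv_keyword_select_le (R : realType) (n : nat) (K : {set 'I_n})
    (u : 'I_n -> R) :
  dotv (keyword_select K u) (keyword_select K u) <= dotv u u.
Proof.
apply: ler_sum => j _; rewrite /keyword_select; case: ifP => // _.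
by rewrite mul0r -expr2 sqr_ge0.
Qed.

Lemma dotvB_nonneg_le (R : realType) (n : nat) (u w : 'I_n -> R) :
  (forall j, 0 <= u j) -> (forall j, 0 <= w j) ->
  dotv (fun j => u j - w j) (fun j => u j - w j) <= dotv u u + dotv w w.
Proof.
move=> u0 w0; rewrite /dotv -big_split /=; apply: ler_sum => j _.
by have := mulr_ge0 (u0 j) (w0 j); nra.
Qed.

Lemma mu_matvec (R : realType) (d V : nat) (A : 'I_d -> 'I_V -> R)
    (phi u w : 'I_V -> R) :
  mu (matvec A phi) (matvec A u) (matvec A w) =
  dotv (matvec A phi) (matvec A (fun j => u j - w j)).
Proof.
apply: eq_bigr => i _; congr (_ * _); rewrite /matvec -sumrB.
by apply: eq_bigr => j _; rewrite mulrBr.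
Qed.

Lemma measure_bigcup_ord_le (R : realType) (M : nat) (dT : measure_display)
    (T : measurableType dT) (P : probability T R) (A : 'I_M -> set T) (b : R) :
  (forall i, measurable (A i)) -> (forall i, (P (A i) <= b%:E)%E) ->
  (P [set t | exists i, A i t] <= (M%:R * b)%:E)%E.
Proof.
move=> mA PA.
(* Boole's inequality is applied to a sequence indexed by [nat], so the family is padded with empty
   sets. *)
pose A' k := if insub k is Some i then A i else set0.
have A'E (i : 'I_M) : A' i = A i by rewrite /A' valK.
have -> : [set t | exists i, A i t] = \big[setU/set0]_(i < M) A' i.
  rewrite -bigcup_mkord; apply/seteqP; split => t /=.
    by move=> [i Ait]; exists i; rewrite /= ?A'E.
  by move=> [k /= kM]; rewrite (A'E (Ordinal kM)) => Akt; exists (Ordinal kM).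
apply: (le_trans (Boole_inequality _ _)).
  by move=> k kM; rewrite (A'E (Ordinal kM)).
apply: (@le_trans _ _ (\sum_(i < M) b%:E)%E).
  by apply: lee_sum => i _; rewrite A'E; exact: PA.
by rewrite sumEFin sumr_const card_ord mulr_natl.
Qed.

Theorem theorem1 (R : realType) (V d L M : nat)
  (phi : 'I_V -> R) (w : 'I_L -> 'I_V -> R)
  (p : 'I_L) (n : 'I_M -> 'I_L)
  (K : 'I_L -> {set 'I_V}) (delta eps : R)
  (dT : measure_display) (T : measurableType dT) (P : probability T R)
  (E : 'I_d -> 'I_V -> T -> R) :
  (0 < V)%N -> (0 < d)%N -> (0 < M)%N ->
  (forall j, 0 <= phi j) -> norm2 phi = 1 ->
  (forall l j, 0 <= w l j) -> (forall l, norm2 (w l) <= 1) ->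
  injective n -> (forall i, n i != p) ->
  (forall i, 0 < mu phi (w p) (w (n i))) ->
  0 < delta ->
  (let v := fun l => keyword_select (K l) (w l) in
   (forall l, (l = p \/ exists i, l = n i) ->
      dotv phi (v l) >= dotv phi (w l) - delta) ->
   (forall i, eps <= mu phi (v p) (v (n i))) ->
   (exists i, eps = mu phi (v p) (v (n i))) ->
   mutually_independent P (fun ij : 'I_d * 'I_V => E ij.1 ij.2) ->
   (forall i j, normally_distributed P (E i j) 0 (Num.sqrt (d%:R^-1))) ->
   let Ew := fun t => matvec (fun i j => E i j t) in
   let U := [set t | exists i, mu (Ew t phi) (Ew t (v p)) (Ew t (v (n i))) <= 0] in
   (delta <= eps ->
      (P U <= (4 * M%:R * expR (- ((eps - delta) ^+ 2 * d%:R / 50)))%:E)%E) /\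
   (eps - delta >= 10 * Num.sqrt (ln M%:R / d%:R) ->
      (P U <= (M%:R^-1)%:E)%E)).
Proof.
move=> _ d0 M0 _ phi1 w0 w1 _ _ _ delta0 v _ epsle _ indepE normalE Ew U.
have d_gt0 : 0 < d%:R :> R by rewrite ltr0n.
have M_gt0 : 0 < M%:R :> R by rewrite ltr0n.
have sqr_norm2 (u : 'I_V -> R) : norm2 u ^+ 2 = dotv u u.
  by rewrite /norm2 sqr_sqrtr// dotvv_ge0.
have {}phi1 : dotv phi phi = 1 by rewrite -sqr_norm2 phi1 expr1n.
have v2 l : dotv (v l) (v l) <= 1.
  rewrite (le_trans (dotv_keyword_select_le _ _))// -sqr_norm2.
  by rewrite expr_le1// sqrtr_ge0.
have v0 l j : 0 <= v l j by rewrite /v /keyword_select; case: ifP.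
have PU : delta <= eps ->
    (P U <= (M%:R * expR (- ((eps - delta) ^+ 2 * d%:R / 50)))%:E)%E.
  move=> de.
  pose a i j := v p j - v (n i) j.
  have UE : U = [set t | exists i, dotv (Ew t phi) (Ew t (a i)) <= 0].
    by apply/seteqP; split => t [i Ui]; exists i; move: Ui; rewrite mu_matvec.
  rewrite UE; apply: measure_bigcup_ord_le => i.
    exact: (measurable_dotv_matvec_le0 normalE).
  apply: (le_trans (gaussian_dotv_le0 d0 indepE normalE phi1 _ _)).
  - apply: (le_trans (dotvB_nonneg_le (v0 p) (v0 (n i)))).
    by have := v2 p; have := v2 (n i); lra.
  - by have := epsle i; rewrite /mu -/(a i); lra.
  (* Here [0 <= eps - delta <= eps <= dotv phi (a i)], so squaring preserves the order. *)
  - have := epsle i; rewrite /mu -/(a i) => ei.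
    rewrite lee_fin ler_expR lerN2 !ler_pM2r ?invr_gt0//.
    by rewrite ler_sqr ?nnegrE; lra.
split.
  move=> de; apply: (le_trans (PU de)); rewrite lee_fin -[leRHS]mulrA.
  by rewrite ler_peMl ?mulr_ge0 ?expR_ge0 ?ler1n.
move=> ed.
have lnM0 : 0 <= ln M%:R :> R by rewrite ln_ge0// ler1n.
have ld0 : 0 <= ln M%:R / d%:R :> R by rewrite divr_ge0// ltW.
have s0 : 0 <= 10 * Num.sqrt (ln M%:R / d%:R) :> R by rewrite mulr_ge0 ?sqrtr_ge0.
have de : delta <= eps by rewrite -subr_ge0 (le_trans s0).
apply: (le_trans (PU de)); rewrite lee_fin.
(* Dividing by 50 turns 100 into 2: the exponential is at most [M ^- 2], and the union over [M]
   events leaves [M^-1]. *)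
have e2 : 100 * ln M%:R <= (eps - delta) ^+ 2 * d%:R.
  have : (10 * Num.sqrt (ln M%:R / d%:R)) ^+ 2 <= (eps - delta) ^+ 2.
    by rewrite ler_sqr ?nnegrE// (le_trans s0).
  rewrite exprMn sqr_sqrtr// mulrA ler_pdivrMr//; lra.
have MlnE : M%:R = expR (ln M%:R) :> R by rewrite lnK ?posrE.
rewrite [leRHS](_ : _ = M%:R * expR (- (2 * ln M%:R))); last first.
  by rewrite {2}MlnE -expRD {1}MlnE -expRN; congr expR; ring.
rewrite ler_pM2l// ler_expR; lra.
Qed.
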